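(* Let $p$ be an odd prime, $q=p^n\equiv 1\pmod 4$ and $q=4f+1$. Let $G=(\mathbb{F}_q,+)$ and let $w$ be a generator of $\mathbb{F}_q^*$, with cyclotomic classes $C_0,C_1,C_2,C_3$ of order $4$ defined from $w$. If $p\equiv -1\pmod 4$, let $s=(-p)^{n/2}$ and $t=0$. If $p\equiv 1\pmod 4$, let the integer $s$ be uniquely determined by $q=s^2+t^2$, $p\nmid s$, $s\equiv 1\pmod 4$, and let the integer $t$ be uniquely determined by $w^{(q-1)/4}\equiv s/t\pmod p$. If $P=C_i$ and $N=G-C_i-C_j-0_G$ with $\{i,j\}\subset\{0,1,2,3\}$ and $i\neq j$, then $D=P-N$ is a $\left(q,3f,\frac{f-3}{4}\right)$-signed difference set if and only if $f\equiv 3\pmod 4$ and $s,t$ satisfy one of the conditions: 1) $i-j\equiv 1\pmod 4$, $3s+4t=-1$; 2) $i-j\equiv 2\pmod 4$, $s=-3$; 3) $i-j\equiv 3\pmod 4$, $3s-4t=-1$.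
   Context: The cyclotomic classes of order $4$ are $C_0=\{w^{4j}:0\le j\le f-1\}$ and $C_i=w^iC_0$ for $0\le i\le 3$. In the case $p\equiv 1\pmod 4$, $q=s^2+t^2$ is a representation in integers with $p\nmid s$, $s\equiv 1\pmod 4$ (this fixes $s$ and $|t|$), and the sign of $t$ is fixed by requiring that $w^{(q-1)/4}$, which lies in the prime field $\mathbb{F}_p$, equals $s/t$ in $\mathbb{F}_p$. For $G=(\mathbb{F}_q,+)$ with identity $0_G$, a subset $S\subseteq G$ is identified with $\sum_{s\in S}s$ in the group ring $\mathbb{Z}[G]$; thus $G-C_i-C_j-0_G$ represents $G\setminus(C_i\cup C_j\cup\{0\})$. For disjoint subsets $P,N$ of $G$, the element $D=P-N$ is a signed set of size $k=|P|+|N|$. For $A=\sum_g a_g g\in\mathbb{Z}[G]$, $A^{-1}=\sum_g a_g g^{-1}$ with $g^{-1}$ the inverse of $g$ in $G$ (i.e. the field element $-g$). $D$ is a $(q,k,\lambda)$-signed difference set if $DD^{-1}=\lambda G+(k-\lambda)\cdot 0_G$ in $\mathbb{Z}[G]$, where $\lambda$ is an integer. *)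

(* Defs.v *)
From mathcomp Require Import all_boot all_order all_fingroup all_algebra.
From mathcomp Require Import all_solvable all_field.

Set Implicit Arguments.
Unset Strict Implicit.
Unset Printing Implicit Defensive.

Import GRing.Theory Num.Theory.
Local Open Scope ring_scope.

(* The group ring Z[G] of a finite abelian group G, written additively: an
   element A is the finite function of its coefficients.  Sum, opposite and
   integer multiples are those of {ffun G -> int}; the group ring product is
   gr_mul, NOT the pointwise product that {ffun G -> int} also carries. *)
Definition group_ring (G : finZmodType) := {ffun G -> int}.

Section GroupRing.
Variable G : finZmodType.
Implicit Types (S P N : {set G}) (A B : group_ring G).

Definition gr_of_set S : group_ring G := [ffun g => (g \in S)%:R].

Definition gr_mul A B : group_ring G :=
  [ffun g => \sum_(x : G) A x * B (g - x)].

(* A^{-1} = \sum_g a_g g^{-1}; the inverse of g in G is - g. *)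
Definition gr_inv A : group_ring G := [ffun g => A (- g)].

Definition signed_element P N : group_ring G := gr_of_set P - gr_of_set N.

Definition signed_difference_set P N (v k : nat) (lambda : int) : Prop :=
  let D := signed_element P N in
  [/\ [disjoint P & N], #|G| = v, (#|P| + #|N|)%N = k
    & gr_mul D (gr_inv D)
      = gr_of_set [set: G] *~ lambda + gr_of_set [set 0] *~ (k%:Z - lambda)].

End GroupRing.

Definition cyclotomic_class0 (F : finFieldType) (w : F) (f : nat) : {set F} :=
  [set w ^+ (4 * j) | j : 'I_f].

Definition cyclotomic_class (F : finFieldType) (w : F) (f i : nat) : {set F} :=
  [set w ^+ i * x | x in cyclotomic_class0 w f].

(* Main.v *)
(** Let A(g) be the coefficients of D D^{-1}.  If f = 3 mod 4, then p = 1 mod 4 and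
-1 lies in C_2, so that for g <> 0 the value A(g) only depends on the quadratic
character eta of g.  The sum of all A(g) is known, hence D is a signed difference
set iff \sum_g eta(g) A(g) = 0.  This sum equals f times a linear form in the
integers N_k = \sum_(u in C_k) eta(1 - u), and the Jacobi sum J(chi, eta) of a
quartic character chi is (2 N_0 + 1) + 2 N_1 i.  Its norm is q; reducing it modulo p
at i = w^f gives 0, while its conjugate reduces to the binomial coefficient
C(2f, f), which is a unit modulo p.  Together with the parity of N_0 this forces
2 N_0 + 1 = s and 2 N_1 = - t, which turns the linear form into the three
conditions. *)

Require Import Defs.
From mathcomp Require Import all_boot all_order all_fingroup all_algebra.
From mathcomp Require Import all_solvable all_field.
From mathcomp Require Import zify ring.
Import GRing.Theory Num.Theory.
Local Open Scope ring_scope.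

Set Implicit Arguments.
Unset Strict Implicit.
Unset Printing Implicit Defensive.

(** * Sums of two squares and central binomial coefficients *)

(** The product of [a * t + b * s] and [a * t - b * s] is a multiple of [q = p ^ n], and the second
    factor is prime to [p]. So [q] divides the first, which size and parity then force to vanish.
    The congruences modulo 4 settle the sign of [a]. *)
Lemma sum_two_squares_sign (p n : nat) (a b s t : int) :
  prime p -> odd p ->
  (p ^ n)%:Z = a ^+ 2 + b ^+ 2 -> (p ^ n)%:Z = s ^+ 2 + t ^+ 2 ->
  (a = 1 %[mod 4])%Z -> (s = 1 %[mod 4])%Z ->
  ~~ (p%:Z %| a * t - b * s)%Z -> a = s /\ b = - t.
Proof.
have oddE (m : nat) : odd m -> m%:Z = 2 * (m./2)%:Z + 1 by lia.
have mod4E (x : int) : (x = 1 %[mod 4])%Z -> x = 4 * (x %/ 4)%Z + 1 by lia.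
have mod2E (x : int) : x = 2 * (x %/ 2)%Z \/ x = 2 * (x %/ 2)%Z + 1 by lia.
have half1 (x : int) : 2 * x <> 1 by lia.
have sq_le1 (x : int) : (2 * x) ^+ 2 <= 1 -> x = 0 by nia.
have opp_mod4 (x y : int) :
  x = 4 * y + 1 -> - x = 4 * (- x %/ 4)%Z + 1 -> False by lia.
move=> p_pr p_odd; set q := (p ^ n)%N => qa qs /mod4E a1 /mod4E s1 pN.
have qodd : odd q by rewrite oddX p_odd orbT.
have q0 : (0 < q)%N by rewrite expn_gt0 prime_gt0.
have prod : (a * t + b * s) * (a * t - b * s) = q%:Z * (a ^+ 2 - s ^+ 2).
  have b2 : b ^+ 2 = q%:Z - a ^+ 2 by rewrite qa addrC addKr.
  have t2 : t ^+ 2 = q%:Z - s ^+ 2 by rewrite qs addrC addKr.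
  transitivity (a ^+ 2 * t ^+ 2 - b ^+ 2 * s ^+ 2); first by ring.
  by rewrite b2 t2; ring.
have : (q%:Z %| a * t + b * s)%Z.
  rewrite -(@Gauss_dvdzl _ _ (a * t - b * s)) ?prod ?dvdz_mulr //.
  by rewrite coprimezE /= coprimeXl // prime_coprime.
case/dvdzP => c hc.
have sq : (a * t + b * s) ^+ 2 + (a * s - b * t) ^+ 2 = q%:Z ^+ 2.
  by rewrite [RHS]expr2 {1}qa qs; ring.
have q1 := oddE _ qodd.
have even_part x y : q%:Z = x ^+ 2 + y ^+ 2 -> x = 4 * (x %/ 4)%Z + 1 ->
    y = 2 * (y %/ 2)%Z.
  set x' := (x %/ 4)%Z => hq hx; case: (mod2E y) => //.
  set y' := (y %/ 2)%Z => hy.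
  case: (half1 (q./2%:Z - 8 * x' ^+ 2 - 4 * x' - 2 * y' ^+ 2 - 2 * y')).
  by apply: (addIr (x ^+ 2 + y ^+ 2)); rewrite -[in RHS]hq q1 hx hy; ring.
have b0 := even_part _ _ qa a1; have t0 := even_part _ _ qs s1.
(* The left-hand side of [hc] is even and at most q in absolute value. *)
have c0 : c = 0.
  have ceven : c = 2 * (c %/ 2)%Z.
    case: (mod2E c) => //; set c' := (c %/ 2)%Z => co.
    case: (half1 (a * (t %/ 2)%Z + (b %/ 2)%Z * s - c' * q%:Z - q./2%:Z)).
    apply: (addIr (c * q%:Z)); rewrite -[in RHS]hc co q1 [in RHS]b0 [in RHS]t0; ring.
  have : (c * q%:Z) ^+ 2 <= q%:Z ^+ 2 by rewrite -hc -sq lerDl sqr_ge0.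
  rewrite exprMn -[X in _ <= X]mul1r ler_pM2r ?exprn_gt0 //.
  by rewrite ceven => /sq_le1 ->; rewrite mulr0.
have as2 : a ^+ 2 == s ^+ 2.
  move/eqP: prod; rewrite hc c0 !mul0r eq_sym mulf_eq0 subr_eq0.
  by rewrite -[_ == 0]/(q == 0)%N gtn_eqF.
have a_s : a = s.
  move: as2; rewrite eqf_sqr => /orP[/eqP//|/eqP as_].
  by case: (opp_mod4 _ _ s1); rewrite -as_.
split=> //; have : a * (t + b) == 0.
  by rewrite mulrDr {2}a_s [s * b]mulrC hc c0 mul0r.
rewrite mulf_eq0 addr_eq0 => /orP[/eqP a0|/eqP ->]; last by rewrite opprK.
have a4 : 4 * (a %/ 4)%Z + 1 = 0 by rewrite -a1.
by case: (half1 (- 2 * (a %/ 4)%Z)); rewrite -[RHS]subr0 -a4; ring.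
Qed.

(** An even [n] would give [p ^ n = 1] modulo 8 and hence an even [f]; an odd [n] gives [p ^ n = p]
    modulo 4. *)
Lemma prime_1_mod4 (p n f : nat) : prime p -> odd p ->
  (p ^ n = 4 * f + 1)%N -> odd f -> (p %% 4 = 1)%N.
Proof.
move=> p_pr p_odd qE f_odd.
have p2 : (p ^ 2 %% 8 = 1)%N.
  have p8 : (p %% 8 < 8)%N by rewrite ltn_mod.
  rewrite -modnXm; have : odd (p %% 8) by rewrite odd_mod.
  by case: (p %% 8)%N p8 => [|[|[|[|[|[|[|[|]]]]]]]].
have [n_odd|n_even] := boolP (odd n).
  have : (p ^ n = p %[mod 4])%N.
    rewrite -(odd_double_half n) n_odd add1n expnS -mul2n expnM -modnMmr.
    rewrite -modnXm (_ : p ^ 2 %% 4 = 1)%N ?exp1n ?modnMmr ?muln1 //.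
    by move: p2; lia.
  by rewrite qE; lia.
have : (p ^ n %% 8 = 1)%N.
  by rewrite -(even_halfK n_even) -mul2n expnM -modnXm p2 exp1n.
by rewrite qE; lia.
Qed.

Lemma central_bin_pmod4 (p n f : nat) : prime p -> (p %% 4 = 1)%N ->
  (p ^ n = 4 * f + 1)%N -> ~~ (p %| 'C(2 * f, f))%N.
Proof.
move=> p_pr p1 qE; have p_gt0 := prime_gt0 p_pr.
have pX1 k : (p ^ k %% 4 = 1)%N by rewrite -modnXm p1 exp1n.
(* Legendre's formula: in base p every digit of f is (p - 1) / 4, so doubling f
   creates no carry. *)
have half k : ((2 * f) %/ p ^ k = 2 * (f %/ p ^ k))%N.
  have [kn|nk] := leqP k n; last first.
    have : (p ^ n < p ^ k)%N by rewrite ltn_exp2l ?prime_gt1.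
    by rewrite qE => h; rewrite !divn_small //; lia.
  have [r rE] : exists r, (p ^ k = 4 * r + 1)%N.
    by exists (p ^ k %/ 4)%N; rewrite {1}(divn_eq (p ^ k) 4) pX1 mulnC.
  have [c cE] : exists c, (p ^ (n - k) = 4 * c + 1)%N.
    by exists (p ^ (n - k) %/ 4)%N; rewrite {1}(divn_eq (p ^ (n - k)) 4) pX1 mulnC.
  (* From [p ^ n = p ^ k * p ^ (n - k)]: [f] has remainder [r] modulo [p ^ k], and [2 * r] is still
     below [p ^ k]. *)
  have fE : (f = c * (4 * r + 1) + r)%N.
    by move: qE; rewrite -(subnK kn) expnD rE cE; nia.
  rewrite rE fE mulnDr mulnA !divnMDl ?addn1 // !divn_small //; lia.
have := bin_fact (leq_pmull f (isT : 0 < 2)%N).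
move=> /(congr1 (logn p)).
have -> : (2 * f - f = f)%N by lia.
have C0 : (0 < 'C(2 * f, f))%N by rewrite bin_gt0; lia.
rewrite !lognM ?muln_gt0 ?fact_gt0 // !logn_fact // => h.
have ext : (\sum_(1 <= k < (2 * f).+1) f %/ p ^ k = \sum_(1 <= k < f.+1) f %/ p ^ k)%N.
  rewrite (big_cat_nat (n := f.+1)) //= ?ltnS ?leq_pmull //.
  rewrite -[RHS]addn0; congr (_ + _)%N.
  rewrite big_nat_cond big1 // => k /andP[/andP[fk _] _].
  by rewrite divn_small // (ltn_trans fk) // ltn_expl // prime_gt1.
have {h} : logn p 'C(2 * f, f) = 0%N.
  move/eqP: h; rewrite (eq_bigr _ (fun k _ => half k)) -big_distrr /= ext.
  by rewrite [X in _ == X]mul2n -addnn -[X in _ == X]add0n eqn_add2r => /eqP.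
by move/eqP; rewrite -[_ == _]negbK -lt0n logn_gt0 mem_primes p_pr C0.
Qed.

(** * Quartic characters and Jacobi sums *)

Section Quartic.

Variables (F : finFieldType) (f : nat) (w : F).
Hypotheses (cardF : #|F| = (4 * f + 1)%N) (w_prim : (4 * f).-primitive_root w).

Local Notation iota := (w ^+ f).

Let f_gt0 : (0 < f)%N.
Proof. by have := prim_order_gt0 w_prim; rewrite muln_gt0. Qed.

Lemma iota_primitive : 4.-primitive_root iota.
Proof.
have := dvdn_prim_root w_prim (dvdn_mulr f (dvdnn 4)).
by rewrite mulKn.
Qed.
Let iota_prim := iota_primitive.

Lemma iota_sqr : iota ^+ 2 = -1.
Proof.
have := prim_expr_order iota_prim; rewrite (exprM _ 2 2) => /eqP.
rewrite -subr_eq0 subr_sqr_1 mulf_eq0 => /orP[]; last by rewrite addr_eq0 => /eqP.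
rewrite subr_eq0 => /eqP h.
by have := prim_order_dvd iota_prim 2; rewrite h eqxx.
Qed.

Lemma expf_card_pred (x : F) : x != 0 -> x ^+ (4 * f) = 1.
Proof.
move=> x0; have := expf_card x; rewrite cardF addn1 exprS => h.
by apply: (mulfI x0); rewrite h mulr1.
Qed.

Lemma expf_iota (x : F) : x != 0 -> exists k : 'I_4, x ^+ f = iota ^+ k.
Proof.
move=> x0; have x1 : (x ^+ f) ^+ 4 = 1 by rewrite -exprM mulnC expf_card_pred.
by have [k ->] := prim_rootP iota_prim x1; exists k.
Qed.

Lemma expr0n_iotaX k : (0 ^+ f == iota ^+ k) = false.
Proof.
rewrite expr0n gtn_eqF //= eq_sym expf_eq0.
by rewrite (prim_root_eq0 iota_prim) andbF.
Qed.

(* Membership in C_k is expressed as [x ^+ f = iota ^+ k], see [cyclotomic_classE]. *)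
Definition class_fun (R : nzRingType) (a : nat -> R) (x : F) : R :=
  \sum_(k < 4 | x ^+ f == iota ^+ k) a k.

Lemma class_fun0 (R : nzRingType) (a : nat -> R) : class_fun a 0 = 0.
Proof. by rewrite /class_fun big1 // => k; rewrite expr0n_iotaX. Qed.

Lemma class_funE (R : nzRingType) (a : nat -> R) (x : F) (k : nat) :
  x ^+ f = iota ^+ k -> class_fun a x = a (k %% 4)%N.
Proof.
move=> xk; rewrite /class_fun (big_pred1 (inord (k %% 4))) => [|m].
  by rewrite inordK ?ltn_mod.
rewrite xk (eq_prim_root_expr iota_prim) /= -val_eqE /= inordK ?ltn_mod //.
by rewrite (modn_small (ltn_ord m)) eq_sym.
Qed.

Lemma sum_class_fun (R : nzRingType) (a : nat -> R) (E : F -> R) :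
  \sum_x class_fun a x * E x
    = \sum_(k < 4) a k * \sum_(x | x ^+ f == iota ^+ k) E x.
Proof.
under eq_bigr do rewrite mulr_suml big_mkcond.
rewrite exchange_big; apply: eq_bigr => k _ /=.
by rewrite -big_mkcond mulr_sumr.
Qed.

(* The multiplicative character sending [w] to [zeta], for [zeta ^+ 4 = 1]; the
   quadratic character is [chi (-1)].  Over [R = F] it is a power map
   ([chi_iotaX]), which gives the reduction modulo p for free. *)
Definition chi (R : nzRingType) (zeta : R) : F -> R :=
  class_fun (fun k => zeta ^+ k).

Lemma chi0 (R : nzRingType) (zeta : R) : chi zeta 0 = 0.
Proof. exact: class_fun0. Qed.

Lemma chiE (R : nzRingType) (zeta : R) (x : F) (k : nat) :
  zeta ^+ 4 = 1 -> x ^+ f = iota ^+ k -> chi zeta x = zeta ^+ k.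
Proof. by move=> z4 xk; rewrite /chi (class_funE _ xk) expr_mod. Qed.

Lemma chiM (R : comNzRingType) (zeta : R) (x y : F) :
  zeta ^+ 4 = 1 -> chi zeta (x * y) = chi zeta x * chi zeta y.
Proof.
move=> z4; have [->|x0] := eqVneq x 0; first by rewrite mul0r chi0 mul0r.
have [->|y0] := eqVneq y 0; first by rewrite mulr0 chi0 mulr0.
have [k xk] := expf_iota x0; have [m ym] := expf_iota y0.
rewrite (@chiE _ _ _ (k + m)) // ?exprMn ?xk ?ym ?exprD //.
by rewrite (chiE z4 xk) (chiE z4 ym).
Qed.

Lemma chi_chi (R : comNzRingType) (zeta xi : R) (x : F) :
  zeta ^+ 4 = 1 -> xi ^+ 4 = 1 ->
  chi zeta x * chi xi x = chi (zeta * xi) x.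
Proof.
move=> z4 x4; have [->|x0] := eqVneq x 0; first by rewrite !chi0 mul0r.
have [k xk] := expf_iota x0.
by rewrite !(@chiE _ _ _ k) ?exprMn ?z4 ?x4 ?mulr1.
Qed.

Lemma chi_iotaX m x : (0 < m)%N -> chi (iota ^+ m) x = x ^+ (f * m).
Proof.
move=> m0; have [->|x0] := eqVneq x 0.
  by rewrite chi0 expr0n muln_eq0 !gtn_eqF.
have [k xk] := expf_iota x0.
have z4 : (iota ^+ m) ^+ 4 = 1.
  by rewrite [_ ^+ 4]exprAC (prim_expr_order iota_prim) expr1n.
by rewrite (chiE z4 xk) exprM xk; apply: exprAC.
Qed.

Lemma chi1 (R : nzRingType) x : chi (1 : R) x = (x != 0)%:R.
Proof.
have [->|x0] := eqVneq x 0; first by rewrite chi0.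
by have [k xk] := expf_iota x0; rewrite (chiE _ xk) ?expr1n.
Qed.

Lemma chi_at1 (R : nzRingType) (zeta : R) : zeta ^+ 4 = 1 -> chi zeta 1 = 1.
Proof. by move=> z4; rewrite (@chiE _ _ _ 0) ?expr0 // expr1n. Qed.

Lemma chi_at_w (R : nzRingType) (zeta : R) : zeta ^+ 4 = 1 -> chi zeta w = zeta.
Proof. by move=> z4; rewrite (@chiE _ _ _ 1) ?expr1. Qed.

Lemma w_neq0 : w != 0.
Proof. by rewrite (prim_root_eq0 w_prim) muln_eq0 /= -lt0n. Qed.

Lemma sum_mull (V : nmodType) (c : F) (E : F -> V) :
  c != 0 -> \sum_x E x = \sum_x E (c * x).
Proof. by move=> c0; rewrite (reindex_inj (mulfI c0)). Qed.

Lemma sum_chi (R : idomainType) (zeta : R) :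
  zeta ^+ 4 = 1 -> zeta != 1 -> \sum_x chi zeta x = 0.
Proof.
move=> z4 z1; have /eqP := sum_mull (chi zeta) w_neq0.
under [X in _ == X]eq_bigr do rewrite chiM // chi_at_w //.
rewrite -mulr_sumr -subr_eq0 -{1}[\sum_x _]mul1r -mulrBl mulf_eq0 subr_eq0.
by rewrite eq_sym (negbTE z1) => /eqP.
Qed.

Lemma sum_nonzero (R : nzRingType) : \sum_(x : F) (x != 0)%:R = (4 * f)%:R :> R.
Proof.
have h := cardC1 (0 : F); rewrite -natr_sum; congr _%:R.
rewrite -(addnK 1%N (4 * f)%N) -cardF subn1 -h -sum1_card [RHS]big_mkcond /=.
by apply: eq_bigr => x _; rewrite !inE; case: (x != 0).
Qed.


(** For nonzero [x] the summand is eta(1 + d / x), and [1 + d / x] runs through all elements except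
    1. The full sum of eta is 0, so minus eta(1) remains. *)
Lemma sum_eta_shift (R : idomainType) (d : F) : 2 != 0 :> R -> d != 0 ->
  \sum_x chi (-1 : R) x * chi (-1) (x + d) = -1.
Proof.
move=> R2 d0; have z4 : (-1 : R) ^+ 4 = 1 by rewrite -signr_odd.
have zn1 : (-1 : R) != 1 by rewrite eq_sym -subr_eq0 opprK.
have -> : \sum_x chi (-1 : R) x * chi (-1) (x + d)
        = \sum_(x | x != 0) chi (-1 : R) (1 + d / x).
  rewrite (bigD1 0) //= chi0 mul0r add0r; apply: eq_bigr => x x0.
  have -> : x + d = x * (1 + d / x) by rewrite mulrDr mulr1 mulrCA divff ?mulr1.
  by rewrite chiM // mulrA chi_chi // mulrNN mulr1 chi1 x0 mul1r.
have := sum_chi z4 zn1; rewrite (bigD1 1) //= chi_at1 //.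
rewrite (reindex_onto (fun x => 1 + d / x) (fun y => d / (y - 1))) /=; last first.
  move=> y y1; rewrite invf_div mulrCA divff ?mulr1 1?addrC ?subrK //.
move=> /eqP; rewrite addrC addr_eq0 => /eqP h; rewrite -[RHS]h; apply: eq_bigl => x.
rewrite -[_ == 1]subr_eq0 [1 + _]addrC addrK mulf_eq0 invr_eq0 (negbTE d0) /=.
by have [->|x0] := eqVneq x 0; rewrite //= invf_div mulrCA divff ?mulr1 ?eqxx.
Qed.

Lemma sum_eta_eta (R : idomainType) (u v : F) : 2 != 0 :> R ->
  \sum_x chi (-1 : R) (x - u) * chi (-1) (x - v)
    = (4 * f + 1)%:R * (u == v)%:R - 1.
Proof.
move=> R2; have z4 : (-1 : R) ^+ 4 = 1 by rewrite -signr_odd.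
rewrite (reindex_inj (addIr u)) /=.
have [->|uv] := eqVneq u v.
  rewrite mulr1 natrD addrK -[RHS]sum_nonzero; apply: eq_bigr => x _.
  by rewrite addrK chi_chi // mulrNN mulr1 chi1.
rewrite mulr0 sub0r -[RHS](@sum_eta_shift _ (u - v)) ?subr_eq0 //.
by apply: eq_bigr => x _; rewrite addrK addrA.
Qed.

Hypothesis f_odd : odd f.

(** For odd [f] the element -1 lies in C_2, since its [f]-th power is [-1 = iota ^+ 2]. *)
Lemma chiN (R : comNzRingType) (zeta : R) x :
  zeta ^+ 4 = 1 -> chi zeta (- x) = zeta ^+ 2 * chi zeta x.
Proof.
move=> z4; rewrite -mulN1r chiM // (@chiE _ _ _ 2) // iota_sqr.
by rewrite -signr_odd f_odd.
Qed.

(** The Jacobi sum of [chi zeta] and the quadratic character. The ring is left free because it is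
    evaluated in [int], in [algC] and in [F] itself. *)
Definition jac (R : nzRingType) (zeta : R) : R :=
  \sum_u chi zeta u * chi (-1) (1 - u).

(** Substituting [x * u] for [u] pulls out both characters at [x]. At [x = 0] the left side is the
    full sum of [chi (- zeta)], a nontrivial character. *)
Lemma jac_shift (R : idomainType) (zeta : R) x : 2 != 0 :> R ->
  zeta ^+ 4 = 1 -> zeta != -1 ->
  \sum_u chi zeta u * chi (-1) (x - u) = chi (- zeta) x * jac zeta.
Proof.
move=> R2 zeta4 zeta1; have z4 : (-1 : R) ^+ 4 = 1 by rewrite -signr_odd.
have nz4 : (- zeta) ^+ 4 = 1 by rewrite -mulN1r exprMn z4 zeta4 mulr1.
have [->|x0] := eqVneq x 0.
  rewrite chi0 mul0r -[RHS](sum_chi nz4) ?eqr_oppLR //; apply: eq_bigr => u _.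
  by rewrite sub0r chiN // sqrrN expr1n mul1r chi_chi // mulrN1.
rewrite (sum_mull _ x0) /jac mulr_sumr; apply: eq_bigr => u _.
rewrite -{2}[x]mulr1 -mulrBr !chiM // -[in RHS](mulrN1 zeta) -chi_chi //; ring.
Qed.

(* Both sides, times [4 * f], are the sum over x of the product of the two
   convolutions evaluated by [jac_shift]. *)
Lemma jac_norm (R : idomainType) (zeta xi : R) : 2 != 0 :> R ->
  (4 * f)%:R != 0 :> R ->
  zeta ^+ 4 = 1 -> xi ^+ 4 = 1 -> zeta * xi = 1 -> zeta != 1 -> zeta != -1 ->
  jac zeta * jac xi = (4 * f + 1)%:R.
Proof.
move=> R2 Rf z4 x4 zx z1 zn1; have n4 : (-1 : R) ^+ 4 = 1 by rewrite -signr_odd.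
have x1 : xi != 1 by apply: contraNneq z1 => x1; rewrite -zx x1 mulr1.
have xn1 : xi != -1.
  by apply: contraNneq zn1 => x1'; rewrite -zx x1' mulrN1 opprK.
pose S := \sum_x (\sum_u chi zeta u * chi (-1) (x - u))
                * (\sum_v chi xi v * chi (-1) (x - v)).
have S1 : S = (4 * f)%:R * (jac zeta * jac xi).
  rewrite -(sum_nonzero R) mulr_suml; apply: eq_bigr => x _.
  rewrite !jac_shift // mulrACA chi_chi ?mulrNN ?zx ?chi1 //;
    by rewrite -mulN1r exprMn n4 ?z4 ?x4 mulr1.
have S2 : S = (4 * f)%:R * (4 * f + 1)%:R.
  transitivity (\sum_u \sum_v chi zeta u * chi xi v
                 * ((4 * f + 1)%:R * (u == v)%:R - 1)).
    rewrite /S; under eq_bigr do rewrite mulr_suml.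
    rewrite exchange_big; apply: eq_bigr => u _ /=.
    under eq_bigr do rewrite mulr_sumr.
    rewrite exchange_big; apply: eq_bigr => v _ /=.
    rewrite -sum_eta_eta // mulr_sumr; apply: eq_bigr => x _; ring.
  (* Only [u = v] meets the term [4 * f + 1]; the constant -1 contributes a product of full
     character sums, which vanishes. *)
  transitivity (\sum_u (chi zeta u * chi xi u * (4 * f + 1)%:R
                        - chi zeta u * \sum_v chi xi v)).
    apply: eq_bigr => u _; under eq_bigr do rewrite mulrBr mulr1.
    rewrite sumrB -[X in _ - X]mulr_sumr; congr (_ - _).
    rewrite (bigD1 u) //= eqxx mulr1 big1 ?addr0 // => v vu.
    by rewrite eq_sym (negbTE vu) !mulr0.
  rewrite sum_chi //; under eq_bigr do rewrite mulr0 subr0 chi_chi // zx chi1.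
  by rewrite -mulr_suml sum_nonzero.
by apply: (mulfI Rf); rewrite -S1 -S2.
Qed.


(** * The integers N_k and the norm of the quartic Jacobi sum *)

Definition cnt (k : nat) : int :=
  \sum_(u | u ^+ f == iota ^+ k) chi (-1 : int) (1 - u).

Lemma eta_intr (R : nzRingType) x : (chi (-1 : int) x)%:~R = chi (-1 : R) x.
Proof.
have z4 (S : nzRingType) : (-1 : S) ^+ 4 = 1 by rewrite -signr_odd.
have [->|x0] := eqVneq x 0; first by rewrite !chi0.
by have [k xk] := expf_iota x0; rewrite !(chiE _ xk) // rmorphXn rmorphN1.
Qed.

Lemma jacE (R : nzRingType) (zeta : R) :
  jac zeta = \sum_(k < 4) zeta ^+ k * (cnt k)%:~R.
Proof.
rewrite /jac /chi sum_class_fun; apply: eq_bigr => k _; congr (_ * _).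
by rewrite rmorph_sum; apply: eq_bigr => u _; rewrite /= eta_intr.
Qed.

Lemma jac_1 : jac (1 : int) = -1.
Proof.
have z4 : (-1 : int) ^+ 4 = 1 by [].
have := sum_chi z4 isT; rewrite (reindex_inj (subrI 1)) /= (bigD1 0) //=.
rewrite subr0 chi_at1 // addrC => /eqP; rewrite addr_eq0 => /eqP h.
rewrite -[RHS]h.
rewrite /jac (bigD1 0) //= chi0 mul0r add0r; apply: eq_bigr => x x0.
by rewrite chi1 x0 mul1r.
Qed.

Lemma jac_N1 : jac (-1 : int) = -1.
Proof.
have := @sum_eta_eta int 0 1 isT.
rewrite eq_sym oner_eq0 mulr0 sub0r => h; rewrite -[RHS]h.
apply: eq_bigr => u _; rewrite subr0; congr (_ * _).
by rewrite -opprB chiN // sqrrN expr1n mul1r.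
Qed.

(** The trivial and the quadratic character give N_0 + N_1 + N_2 + N_3 = -1 and N_0 - N_1 + N_2 -
    N_3 = -1. *)
Lemma cnt_rel : cnt 2 = -1 - cnt 0 /\ cnt 3 = - cnt 1.
Proof.
have := jac_1; have := jac_N1; rewrite !jacE !big_ord_recl !big_ord0 /= !intz.
rewrite /bump /= !addn0 !add1n; lia.
Qed.

Lemma jac_cnt (R : comNzRingType) (zeta : R) : zeta ^+ 2 = -1 ->
  jac zeta = (2 * cnt 0 + 1)%:~R + zeta * (2 * cnt 1)%:~R.
Proof.
move=> z2; have z3 : zeta ^+ 3 = - zeta by rewrite exprS z2 mulrN1.
have [e2 e3] := cnt_rel; rewrite jacE !big_ord_recl !big_ord0 /=.
rewrite /bump /= !addn0 !add1n e2 e3 z2 z3 !(rmorphD, rmorphN, rmorphM) /=.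
ring.
Qed.

(** This is [jac_norm] in [algC] for ['i] and its inverse [- 'i]: the two Jacobi sums are conjugate,
    so their product is a sum of two squares. *)
Lemma cnt_norm : (2 * cnt 0 + 1) ^+ 2 + (2 * cnt 1) ^+ 2 = (4 * f + 1)%:Z.
Proof.
have i2 : ('i : algC) ^+ 2 = -1 by exact: sqrCi.
have i4 : ('i : algC) ^+ 4 = 1 by rewrite (exprM _ 2 2) i2 sqrrN expr1n.
have iN1 (z : algC) : z ^+ 2 = -1 -> z != 1 /\ z != -1.
  move=> z2; have h : (1 : algC) != -1.
    by rewrite -subr_eq0 opprK (pnatr_eq0 _ 2).
  by split; apply: contraNneq h => z1; rewrite -z2 z1 ?sqrrN expr1n.
have ni2 : (- 'i : algC) ^+ 2 = -1 by rewrite sqrrN.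
have [i1 in1] := iN1 _ i2.
have := @jac_norm algC 'i (- 'i).
rewrite !pnatr_eq0 muln_eq0 /= (gtn_eqF f_gt0) mulrN -expr2 i2 opprK.
rewrite -[(- 'i) ^+ 4]/((- 'i) ^+ (2 * 2)) exprM ni2 sqrrN expr1n.
move=> /(_ isT isT i4 erefl erefl i1 in1); rewrite !jac_cnt // => h.
apply: (intr_inj (R := algC)); rewrite rmorphD !rmorphXn /= -[RHS]pmulrn -h.
set u := _%:~R; set v := _%:~R; have -> : v ^+ 2 = - ('i ^+ 2 * v ^+ 2).
  by rewrite i2 mulN1r opprK.
ring.
Qed.

(** * Jacobi sums with values in F *)

Lemma natr_cardF : #|F|%:R = 0 :> F.
Proof.
have h : \sum_(x : F) x = \sum_(x : F) (x + 1).
  by rewrite (reindex_inj (addIr 1)).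
by apply: (addrI (\sum_(x : F) x)); rewrite addr0 {2}h big_split /= sumr_const.
Qed.

(** Multiplying the variable by [w] scales the sum by [w ^+ m], so it vanishes unless [w ^+ m = 1].
    In that case it counts the nonzero elements, and [4 * f] is -1 in [F]. *)
Lemma sum_exprn m : (0 < m)%N ->
  \sum_(x : F) x ^+ m = - (4 * f %| m)%:R.
Proof.
move=> m0; have [dm|dm] := boolP (4 * f %| m)%N; last first.
  have /eqP := sum_mull (fun x : F => x ^+ m) w_neq0.
  under [X in _ == X]eq_bigr do rewrite exprMn.
  rewrite -mulr_sumr -subr_eq0 -{1}[\sum_x _]mul1r -mulrBl mulf_eq0 subr_eq0.
  rewrite eq_sym -(prim_order_dvd w_prim) (negbTE dm) /= => /eqP ->.
  by rewrite oppr0.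
have -> : \sum_(x : F) x ^+ m = \sum_(x : F) (x != 0)%:R.
  apply: eq_bigr => x _; have [->|x0] := eqVneq x 0.
    by rewrite expr0n gtn_eqF.
  by have /dvdnP[c ->] := dm; rewrite mulnC exprM expf_card_pred ?expr1n.
rewrite sum_nonzero -[RHS]add0r -[0 in RHS]natr_cardF cardF natrD addrK.
by [].
Qed.

Lemma two_neq0 : 2 != 0 :> F.
Proof.
have := prim_root_natf_neq0 w_prim; apply: contraNneq => h.
by rewrite natrM (natrM _ 2 2) h !mul0r.
Qed.

(** In [F] both characters are power maps: expand [(1 - u) ^+ (2 * f)] by the binomial formula and
    sum the powers of [u]. *)
Lemma jac_F m : (0 < m)%N ->
  jac (iota ^+ m)
    = \sum_(j < (2 * f).+1) (-1) ^+ j *+ 'C(2 * f, j)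
                             * - ((4 * f %| f * m + j)%N)%:R.
Proof.
move=> m0; rewrite /jac.
transitivity (\sum_(u : F) \sum_(j < (2 * f).+1)
                 (-1) ^+ j *+ 'C(2 * f, j) * u ^+ (f * m + j)).
  apply: eq_bigr => u _; rewrite -{1}iota_sqr !chi_iotaX //.
  rewrite [(f * 2)%N]mulnC exprDn mulr_sumr; apply: eq_bigr => j _.
  by rewrite expr1n mul1r exprD (exprNn u) mulrnAr mulrnAl mulrCA.
rewrite exchange_big; apply: eq_bigr => j _ /=.
by rewrite -mulr_sumr sum_exprn // addn_gt0 muln_gt0 f_gt0 m0.
Qed.

(** The exponents lie between [f] and [3 * f], so none is a multiple of [4 * f]. *)
Lemma jac_iota : jac iota = 0.
Proof.
rewrite -[iota]expr1 jac_F // big1 // => j _; rewrite gtnNdvd ?oppr0 ?mulr0 //.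
  by rewrite muln1 addn_gt0 f_gt0.
by have := ltn_ord j; lia.
Qed.

(** The exponents run from [3 * f] to [5 * f], and only [j = f] reaches a multiple of [4 * f]; its
    two minus signs cancel since [f] is odd. *)
Lemma jac_iota3 : jac (iota ^+ 3) = 'C(2 * f, f)%:R.
Proof.
have fj : (f < (2 * f).+1)%N by lia.
rewrite jac_F // (bigD1 (Ordinal fj)) //= big1 ?addr0 => [|j].
  have -> : (f * 3 + f = 4 * f)%N by lia.
  by rewrite dvdnn -signr_odd f_odd mulrN1 mulNrn opprK.
rewrite -val_eqE /= => jf; have [/dvdnP[c hc]|] := boolP (_ %| _)%N.
  have := ltn_ord j; move: hc jf; case: c => [|[|c]]; nia.
by rewrite oppr0 mulr0.
Qed.

Lemma cnt_iota : (2 * cnt 0 + 1)%:~R + iota * (2 * cnt 1)%:~R = 0 :> F.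
Proof. by rewrite -jac_cnt ?jac_iota ?iota_sqr. Qed.

(** If the real part vanished in [F], [cnt_iota] would kill the imaginary part too, and with it the
    conjugate sum [jac (iota ^+ 3)]. *)
Lemma cnt_unit : 'C(2 * f, f)%:R != 0 :> F -> (2 * cnt 0 + 1)%:~R != 0 :> F.
Proof.
rewrite -jac_iota3 exprS iota_sqr mulrN1 jac_cnt ?sqrrN ?iota_sqr //.
apply: contraNneq => h; have := cnt_iota; rewrite h !add0r mulNr => ->.
by rewrite oppr0.
Qed.

(** * Cyclotomic classes as fibres of the f-th power map, and the signs of s and t *)

Lemma cyclotomic_classE k : cyclotomic_class w f k = [set x | x ^+ f == iota ^+ k].
Proof.
apply/setP => x; rewrite inE; apply/imsetP/eqP => [[y /imsetP[j _ ->] ->]|xk].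
  rewrite exprMn [X in X * _]exprAC -[X in _ * X]exprM mulnAC exprM.
  by rewrite (prim_expr_order w_prim) expr1n mulr1.
have x0 : x != 0.
  by apply/eqP => x0; move/eqP: xk; rewrite x0 expr0n_iotaX.
have [m xm] := prim_rootP w_prim (expf_card_pred x0).
have /eqP := xk; rewrite xm [X in X == _]exprAC (eq_prim_root_expr iota_prim).
move=> /eqP mk.
(* Adding [4 * f * k] does not change the power of [w] and keeps the subtraction of [k] from
   truncating; the division is exact as [m = k] modulo 4. *)
pose c := ((m + 4 * f * k - k) %/ 4)%N.
have cE : (4 * c + k = m + 4 * f * k)%N by rewrite /c; nia.
have cf : (c %% f < f)%N by rewrite ltn_mod.
exists (w ^+ (4 * (c %% f))); first by apply/imsetP; exists (Ordinal cf).
rewrite -exprD addnC; apply/eqP; rewrite (eq_prim_root_expr w_prim).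
by rewrite muln_modr modnDml cE addnC [(4 * f * k)%N]mulnC modnMDl.
Qed.

Lemma card_class k : #|[set x | x ^+ f == iota ^+ k]| = f.
Proof.
rewrite -cyclotomic_classE card_imset => [|x y]; last first.
  by apply: mulfI; rewrite expf_neq0 // w_neq0.
rewrite card_imset ?card_ord // => i j /eqP.
rewrite (eq_prim_root_expr w_prim) -!muln_modr !modn_small ?ltn_ord //.
by rewrite eqn_pmul2l // => /eqP /val_inj.
Qed.

(** Modulo 2, N_0 counts the elements of C_0 other than 1, and there are [f - 1] of them. This makes
    [2 * cnt 0 + 1] congruent to 1 modulo 4. *)
Lemma cnt0_even : (2 %| cnt 0)%Z.
Proof.
have z4 : (-1 : int) ^+ 4 = 1 by [].
have h x : (2 %| (chi (-1 : int) x + (x != 0)%:R)%R)%Z.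
  have [->|x0] := eqVneq x 0; first by rewrite chi0.
  by have [k xk] := expf_iota x0; rewrite (chiE z4 xk) -signr_odd; case: odd.
have hs : (2 %| (cnt 0 + \sum_(u | u ^+ f == iota ^+ 0) (1 - u != 0)%:R)%R)%Z.
  by rewrite -big_split /=; apply: rpred_sum => u _.
move: hs; rewrite rpredDr // (bigD1 1) /=; last by rewrite expr1n.
have := card_class 0; rewrite (cardsD1 1) inE expr1n eqxx add1n => c.
rewrite subrr eqxx add0r (eq_bigr (fun=> 1)) => [|u /andP[_ u1]]; last first.
  by rewrite subr_eq0 eq_sym u1.
rewrite sumr_const.
have -> : #|[pred u | (u ^+ f == iota ^+ 0) && (u != 1)]| = f.-1.
  by rewrite -(congr1 predn c) /=; apply: eq_card => u; rewrite !inE andbC.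
by clear -f_gt0 f_odd; rewrite dvdzE natz dvdn2; lia.
Qed.


Lemma cnt_sum_two_squares (p n : nat) (s t : int) :
  prime p -> odd p -> (p ^ n = 4 * f + 1)%N ->
  (4 * f + 1)%:Z = s ^+ 2 + t ^+ 2 -> (s = 1 %[mod 4])%Z ->
  iota = s%:~R / t%:~R -> 2 * cnt 0 + 1 = s /\ 2 * cnt 1 = - t.
Proof.
move=> p_pr p_odd qE st s1 iE.
have pF : p \in [pchar F] by apply: (@card_finPcharP _ _ n); rewrite ?cardF ?qE.
have iota0 : iota != 0 by rewrite (prim_root_eq0 iota_prim).
(* Division by zero yields 0, whereas [iota] is nonzero. *)
have t0 : t%:~R != 0 :> F.
  by apply: contraNneq iota0 => t0; rewrite iE t0 invr0 mulr0.
have sE : s%:~R = iota * t%:~R :> F by rewrite iE divfK.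
apply: (@sum_two_squares_sign p n) => //; rewrite ?qE ?cnt_norm //.
  by case/dvdzP: cnt0_even => c ->; clear; lia.
(* Let a = [2 * cnt 0 + 1] and b = [2 * cnt 1]. In [F], iota b = -a and s = iota t, so a t - b s = 2
   a t. *)
rewrite (dvdz_pcharf pF) rmorphB /= (intrM _ _ t) (intrM _ _ s) sE.
have -> : (2 * cnt 1)%:~R * (iota * t%:~R) = - (2 * cnt 0 + 1)%:~R * t%:~R :> F.
  have /eqP := cnt_iota; rewrite addrC addr_eq0 => /eqP <-.
  by rewrite mulrCA mulrA.
rewrite mulNr opprK -mulr2n -(mulr_natl (_ * _)) !mulf_neq0 ?two_neq0 //.
apply: cnt_unit; rewrite -(dvdn_pcharf pF) (central_bin_pmod4 p_pr _ qE) //.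
by rewrite (prime_1_mod4 p_pr p_odd qE).
Qed.

(** * Autocorrelation of class functions *)

Section Autocorrelation.

Variable a : nat -> int.
Local Notation D := (class_fun a).

(** The coefficient of D D^{-1} at [g], for D constant on each cyclotomic class. *)
Definition autocorr (g : F) : int := \sum_x D x * D (x - g).

Lemma class_fun_w4 x : D (w ^+ 4 * x) = D x.
Proof.
rewrite /class_fun; apply: eq_bigl => k; rewrite exprMn [X in X * _]exprAC.
by rewrite (prim_expr_order iota_prim) mul1r.
Qed.

Lemma autocorrN g : autocorr (- g) = autocorr g.
Proof.
rewrite /autocorr (reindex_inj (addIr (- g))) /=; apply: eq_bigr => x _.
by rewrite opprK subrK mulrC.
Qed.

Lemma autocorr_w4 j g : autocorr (w ^+ (4 * j) * g) = autocorr g.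
Proof.
elim: j => [|j IH]; first by rewrite muln0 mul1r.
rewrite -IH mulnSr addnC exprD -mulrA; set h := _ * g.
rewrite /autocorr (sum_mull _ (expf_neq0 4 w_neq0)); apply: eq_bigr => x _.
by rewrite -mulrBr !class_fun_w4.
Qed.

(** Since [f] is odd, [-1 = w ^+ (2 * f)] is [w ^+ 2] times a fourth power; invariance under
    negation and under fourth powers combine. *)
Lemma autocorr_w2 g : autocorr (w ^+ 2 * g) = autocorr g.
Proof.
rewrite -[RHS]autocorrN -(autocorr_w4 f./2) mulrA -exprD.
have -> : (4 * f./2 + 2 = f * 2)%N by have := odd_double_half f; lia.
by rewrite exprM iota_sqr mulN1r.
Qed.

(** The autocorrelation is constant on nonzero squares and on nonsquares. The factor 2 avoids halves
    in [int]. *)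
Lemma autocorr_eta g : g != 0 ->
  2 * autocorr g = (autocorr 1 + autocorr w)
                   + chi (-1 : int) g * (autocorr 1 - autocorr w).
Proof.
move=> g0; have [m ->] := prim_rootP w_prim (expf_card_pred g0).
have -> : chi (-1 : int) (w ^+ m) = (-1) ^+ m by apply: chiE; rewrite 1?exprAC.
rewrite -signr_odd -{1}(odd_double_half m) exprD -mul2n [w ^+ _ * _]mulrC.
have -> h : autocorr (w ^+ (2 * m./2) * h) = autocorr h.
  elim: m./2 h => [|k IH] h; first by rewrite muln0 mul1r.
  by rewrite mulnSr exprD -mulrA IH autocorr_w2.
by case: odd; rewrite ?expr1 ?expr0; ring.
Qed.

Lemma sum_autocorr : \sum_g autocorr g = (\sum_x D x) ^+ 2.
Proof.
rewrite exchange_big expr2 mulr_suml /=; apply: eq_bigr => x _.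
rewrite -mulr_sumr; congr (_ * _); rewrite [RHS](reindex_inj (subrI x)) /=.
by apply: eq_bigr.
Qed.

(** With [g = x - y] and [y] in C_l, put [x = y * u]: the character splits into (-1)^l and eta(u -
    1) = eta(1 - u). If [x] lies in C_m then [u] lies in C_(m-l), written [m + 3 * l] to stay in
    [nat]. *)
Lemma sum_eta_autocorr :
  \sum_g chi (-1 : int) g * autocorr g
    = f%:Z * \sum_(l < 4) \sum_(m < 4) (-1) ^+ l * a l * a m * cnt (m + 3 * l).
Proof.
transitivity (\sum_y D y * \sum_x D x * chi (-1 : int) (x - y)).
  under eq_bigr do rewrite mulr_sumr.
  rewrite exchange_big /=; under [RHS]eq_bigr do rewrite mulr_sumr.
  rewrite [RHS]exchange_big /=; apply: eq_bigr => x _.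
  rewrite (reindex_inj (subrI x)) /=; apply: eq_bigr => y _.
  by rewrite subKr; ring.
have iota0 : iota != 0 by rewrite (prim_root_eq0 iota_prim).
rewrite sum_class_fun mulr_sumr; apply: eq_bigr => l _.
have inner y : y ^+ f == iota ^+ l ->
    \sum_x D x * chi (-1 : int) (x - y)
      = \sum_(m < 4) (-1) ^+ l * a m * cnt (m + 3 * l).
  move=> /eqP yl; have y0 : y != 0.
    by apply/eqP => y0; move/eqP: yl; rewrite y0 expr0n_iotaX.
  rewrite sum_class_fun; apply: eq_bigr => m _; rewrite mulrAC mulrC; congr (_ * _).
  rewrite (reindex_inj (mulfI y0)) mulr_sumr; apply: eq_big => [u|u _].
    rewrite -[RHS](inj_eq (mulfI (expf_neq0 l iota0))) exprMn yl -exprD.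
    by rewrite addnCA -mulSn exprD exprM (prim_expr_order iota_prim) expr1n mulr1.
  rewrite -{2}[y]mulr1 -mulrBr chiM // (chiE _ yl) // -(opprB 1 u) chiN //.
  by rewrite sqrrN expr1n mul1r.
rewrite (eq_bigr _ inner) sumr_const -cardsE card_class !mulr_sumr.
rewrite -sumrMnl mulr_sumr; apply: eq_bigr => m _; rewrite -mulr_natl natz; ring.
Qed.

(** The total sum gives A(1) + A(w) = 2 [lam], and the sum weighted by eta is 2f (A(1) - A(w)). So
    its vanishing means that both values equal [lam]. *)
Lemma autocorr_flat (lam : int) :
  4 * f%:Z * lam = (\sum_x D x) ^+ 2 - autocorr 0 ->
  (forall g, g != 0 -> autocorr g = lam)
    <-> \sum_g chi (-1 : int) g * autocorr g = 0.
Proof.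
move=> lamE; have z4 : (-1 : int) ^+ 4 = 1 by [].
pose A1 := autocorr 1; pose Aw := autocorr w.
have T2 : 2 * (\sum_g chi (-1 : int) g * autocorr g) = 4 * f%:Z * (A1 - Aw).
  transitivity (\sum_g (chi (-1 : int) g * (A1 + Aw)
                        + (g != 0)%:R * (A1 - Aw))).
    rewrite mulr_sumr; apply: eq_bigr => g _.
    have [->|g0] := eqVneq g 0; first by rewrite chi0 !mul0r.
    rewrite mulrCA autocorr_eta // mulrDr mulrA chi_chi // mulrNN mulr1 chi1.
    by rewrite g0.
  by rewrite big_split /= -!mulr_suml sum_chi // mul0r add0r sum_nonzero (natz (4 * f)) PoszM.
have S2 : 2 * (\sum_g autocorr g - autocorr 0) = 4 * f%:Z * (A1 + Aw).
  transitivity (\sum_g ((g != 0)%:R * (A1 + Aw)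
                        + chi (-1 : int) g * (A1 - Aw))).
    rewrite (bigD1 0) //= [X in 2 * X]addrC addKr mulr_sumr [RHS](bigD1 0) //= chi0 eqxx.
    rewrite !mul0r !add0r; apply: eq_bigr => g g0.
    by rewrite g0 mul1r autocorr_eta.
  by rewrite big_split /= -!mulr_suml sum_chi // mul0r addr0 sum_nonzero (natz (4 * f)) PoszM.
have f0 : 4 * f%:Z != 0 by rewrite mulf_neq0 // -[_ == _]/(f == 0)%N gtn_eqF.
have lam2 : 2 * lam = A1 + Aw.
  by apply: (mulfI f0); rewrite -S2 mulrCA lamE sum_autocorr.
split=> [flat|T0].
  have : A1 - Aw = 0 by rewrite /A1 /Aw !flat ?subrr ?oner_neq0 ?w_neq0.
  by move=> A0; move: T2; rewrite A0 mulr0; clear; lia.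
have A0 : A1 - Aw = 0 by apply: (mulfI f0); rewrite -T2 T0 !mulr0.
move=> g g0; apply: (@mulfI _ 2) => //; rewrite autocorr_eta //.
by rewrite -/A1 -/Aw A0 mulr0 addr0.
Qed.

End Autocorrelation.

(** * The quadratic form in the class coefficients and the signed difference set *)

Lemma sum_class (a : nat -> int) :
  \sum_x class_fun a x = f%:Z * \sum_(k < 4) a k.
Proof.
under eq_bigr do rewrite -[class_fun a _]mulr1.
rewrite sum_class_fun mulr_sumr; apply: eq_bigr => k _.
by rewrite sumr_const -cardsE card_class natz mulrC.
Qed.

Lemma autocorr0 (a : nat -> int) :
  autocorr a 0 = f%:Z * \sum_(k < 4) a k ^+ 2.
Proof.
rewrite /autocorr sum_class_fun mulr_sumr; apply: eq_bigr => k _.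
rewrite (eq_bigr (fun=> a k)) => [|x /eqP xk]; last first.
  by rewrite subr0 (class_funE _ xk) modn_small.
by rewrite sumr_const -cardsE card_class -mulr_natl natz mulrCA expr2.
Qed.

Lemma cnt_mod k : cnt k = cnt (k %% 4).
Proof.
by apply: eq_bigl => u; rewrite -(expr_mod k (prim_expr_order iota_prim)).
Qed.

(** Indices are reduced modulo 4, then N_2 and N_3 are eliminated by [cnt_rel]. *)
Lemma cnt_form (a : nat -> int) :
  \sum_(l < 4) \sum_(m < 4) (-1) ^+ l * a l * a m * cnt (m + 3 * l)
    = cnt 0 * ((a 0 - a 2) ^+ 2 - (a 1 - a 3) ^+ 2)
      + 2 * cnt 1 * (a 0 - a 2) * (a 1 - a 3) - 2 * (a 0 * a 2 - a 1 * a 3).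
Proof.
have cE k r : (k %% 4 = r)%N -> cnt k = cnt r by move<-; apply: cnt_mod.
have [c2 c3] := cnt_rel.
rewrite !big_ord_recl !big_ord0 /=.
repeat match goal with |- context [cnt ?k] =>
  let r := eval vm_compute in (k %% 4)%N in
  lazymatch k with r => fail | _ => rewrite (cE k r (erefl r)) end
end.
rewrite c2 c3 /bump /=; ring.
Qed.

Definition sds_coef (i j k : nat) : int :=
  (k == i)%:R - ((k != i) && (k != j))%:R.

(** Up to order and sign, [a 0 - a 2] and [a 1 - a 3] are 1 and 0 when i - j = 2 modulo 4, and 2 and
    1 otherwise. The sign of their product separates the first condition from the third. *)
Lemma cnt_form_eq0 (i j : 'I_4) (s t : int) : i != j ->
  2 * cnt 0 + 1 = s -> 2 * cnt 1 = - t ->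
  \sum_(l < 4) \sum_(m < 4)
     (-1) ^+ l * sds_coef i j l * sds_coef i j m * cnt (m + 3 * l) = 0
  <-> [\/ ((i : nat)%:Z - (j : nat)%:Z = 1 %[mod 4])%Z /\ 3 * s + 4 * t = -1,
          ((i : nat)%:Z - (j : nat)%:Z = 2 %[mod 4])%Z /\ s = -3
        | ((i : nat)%:Z - (j : nat)%:Z = 3 %[mod 4])%Z /\ 3 * s - 4 * t = -1].
Proof.
move=> ij s_def t_def; rewrite cnt_form.
have or3_or (A B C : Prop) : (A \/ B \/ C) <-> [\/ A, B | C].
  split=> [[|[]]|[]]; [exact: Or31|exact: Or32|exact: Or33|by left| |].
    by right; left.
  by right; right.
rewrite -or3_or; move: ij.
case: i => [[|[|[|[|i]]]] // hi]; case: j => [[|[|[|[|j]]]] // hj] // _.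
all: rewrite /sds_coef /=; lia.
Qed.

Section SignedDifferenceSet.

Variables i j : 'I_4.
Hypothesis i_neq_j : i != j.

Local Notation P := (cyclotomic_class w f i).
Local Notation N :=
  (~: (cyclotomic_class w f i :|: cyclotomic_class w f j :|: [set 0])).

Lemma mem_class (x : F) (k l : 'I_4) : x ^+ f = iota ^+ k ->
  (x \in cyclotomic_class w f l) = (k == l).
Proof.
move=> xk; rewrite cyclotomic_classE inE xk (eq_prim_root_expr iota_prim).
by rewrite !modn_small.
Qed.

Lemma class_notin0 k : 0 \notin cyclotomic_class w f k.
Proof. by rewrite cyclotomic_classE inE expr0n_iotaX. Qed.

Lemma signed_elementE x : signed_element P N x = class_fun (sds_coef i j) x.
Proof.
rewrite !ffunE !inE; have [->|x0] := eqVneq x 0.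
  by rewrite class_fun0 (negbTE (class_notin0 i)) orbT.
have [k xk] := expf_iota x0; rewrite (class_funE _ xk) modn_small //.
by rewrite orbF !(mem_class _ xk) negb_or.
Qed.

Lemma card_P : #|P| = f.
Proof. by rewrite cyclotomic_classE card_class. Qed.

Lemma card_N : #|N| = (2 * f)%N.
Proof.
have ij0 : [disjoint P & cyclotomic_class w f j].
  apply/pred0P => x /=; apply/negP => /andP[xi xj].
  have x0 : x != 0 by apply: contraTneq xi => ->; apply: class_notin0.
  have [k xk] := expf_iota x0; move: xi xj i_neq_j.
  by rewrite !(mem_class _ xk) => /eqP-> /eqP->; rewrite eqxx.
have := cardsC (P :|: cyclotomic_class w f j :|: [set 0]).
rewrite cardF setUC cardsU1 !inE !(negbTE (class_notin0 _)) /=.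
rewrite cardsU (disjoint_setI0 ij0) cards0 !cyclotomic_classE !card_class.
rewrite -!cyclotomic_classE; clear; lia.
Qed.

Lemma sum_sds_coef : \sum_(k < 4) sds_coef i j k = -1.
Proof.
rewrite !big_ord_recl big_ord0; move: i_neq_j.
by case: i => [[|[|[|[|]]]]] //; case: j => [[|[|[|[|]]]]].
Qed.

Lemma sum_sqr_sds_coef : \sum_(k < 4) sds_coef i j k ^+ 2 = 3.
Proof.
rewrite !big_ord_recl big_ord0; move: i_neq_j.
by case: i => [[|[|[|[|]]]]] //; case: j => [[|[|[|[|]]]]].
Qed.

(** The coefficient at 0 is always [3 * f], so only flatness away from 0 matters. The coefficient
    sum is [- f], and [f ^ 2 - 3 * f = 4 * f * lam] is the count that [autocorr_flat] requires. *)
Lemma sds_autocorr (lam : int) : 4 * lam = f%:Z - 3 ->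
  signed_difference_set P N (4 * f + 1) (3 * f) lam
  <-> \sum_g chi (-1 : int) g * autocorr (sds_coef i j) g = 0.
Proof.
move=> lamE; rewrite -(@autocorr_flat _ lam); last first.
  by rewrite autocorr0 sum_sqr_sds_coef sum_class sum_sds_coef [LHS]mulrAC lamE; ring.
have corrE g : gr_mul (signed_element P N) (gr_inv (signed_element P N)) g
    = autocorr (sds_coef i j) g.
  rewrite ffunE; apply: eq_bigr => x _; rewrite signed_elementE ffunE opprB.
  by rewrite signed_elementE.
have rhsE g : (gr_of_set [set: F] *~ lam
               + gr_of_set [set 0] *~ ((3 * f)%N%:Z - lam)) g
    = lam + (g == 0)%:R * (3 * f%:Z - lam).
  have mulz (A : group_ring F) (z : int) : (A *~ z) g = A g * z.
    case: z => m; first by rewrite -pmulrn ffunMnE -mulr_natr natz.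
    by rewrite NegzE mulrNz !ffunE -pmulrn ffunMnE -mulr_natr natz mulrN.
  by rewrite ffunE !mulz !ffunE !inE mul1r PoszM.
split=> [[_ _ _ /ffunP eqD] g g0|flat].
  by rewrite -corrE eqD rhsE (negbTE g0) mul0r addr0.
split=> //; last 1 first.
- apply/ffunP => g; rewrite corrE rhsE; have [->|g0] := eqVneq g 0.
    by rewrite autocorr0 sum_sqr_sds_coef mul1r addrC subrK mulrC.
  by rewrite flat // mul0r addr0.
- by rewrite disjoints_subset setCK -setUA subsetUl.
- by rewrite card_P card_N; lia.
Qed.

End SignedDifferenceSet.

End Quartic.

(** * From a generator of the unit group to the final equivalence *)

Lemma generator_prim_root (F : finFieldType) (w : {unit F}) (m : nat) :
  #|F| = m.+1 -> (0 < m)%N -> generator [set: {unit F}] w ->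
  m.-primitive_root (val w).
Proof.
move=> cF m0 /eqP gw; have ow : #[w]%g = m.
  by rewrite /order -gw card_finField_unit cF.
apply/andP; split=> //; apply/forallP => k; rewrite unity_rootE.
rewrite -FinRing.val_unitX -[1]FinRing.val_unit1 val_eqE -order_dvdn ow.
apply/eqP; apply/idP/eqP => [mk|->]; last exact: dvdnn.
by apply/eqP; rewrite eqn_leq ltn_ord; apply: dvdn_leq mk.
Qed.

Theorem proposition5p6 (p n q f : nat) (F : finFieldType) (w : {unit F})
    (s t : int) (i j : 'I_4)
    (p_prime : prime p) (p_odd : odd p)
    (qE : q = (p ^ n)%N) (q_mod4 : (q = 1 %[mod 4])%N) (q4f : q = (4 * f + 1)%N)
    (cardF : #|F| = q)
    (w_gen : generator [set: {unit F}] w)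
    (st_pm1 : (p%:Z = -1 %[mod 4])%Z -> s = (- p%:Z) ^+ n./2 /\ t = 0)
    (st_p1 : (p%:Z = 1 %[mod 4])%Z ->
       [/\ q%:Z = s ^+ 2 + t ^+ 2, ~~ (p%:Z %| s)%Z, (s = 1 %[mod 4])%Z
         & val w ^+ ((q - 1) %/ 4)%N = s%:~R / t%:~R])
    (i_neq_j : i != j) :
  let C (k : nat) := cyclotomic_class (val w) f k in
  let P : {set F} := C i in
  let N : {set F} := ~: (C i :|: C j :|: [set 0]) in
  (exists lambda : int,
      lambda%:~R = (f%:R - 3%:R) / 4%:R :> rat /\
      signed_difference_set P N q (3 * f)%N lambda)
  <->
  (f = 3 %[mod 4])%N /\
  [\/ ((i : nat)%:Z - (j : nat)%:Z = 1 %[mod 4])%Z /\ 3 * s + 4 * t = -1,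
      ((i : nat)%:Z - (j : nat)%:Z = 2 %[mod 4])%Z /\ s = -3
    | ((i : nat)%:Z - (j : nat)%:Z = 3 %[mod 4])%Z /\ 3 * s - 4 * t = -1].
Proof.
move=> C P N.
have f_gt0 : (0 < f)%N.
  by move: (finNzRing_gt1 F); rewrite cardF q4f addn1 ltnS muln_gt0.
have w_prim : (4 * f).-primitive_root (val w).
  apply: generator_prim_root => //; first by rewrite cardF q4f addn1.
  by rewrite muln_gt0 f_gt0.
have cF : #|F| = (4 * f + 1)%N by rewrite cardF.
have fform (f3 : (f = 3 %[mod 4])%N) (lam : int) : 4 * lam = f%:Z - 3 ->
   (signed_difference_set P N q (3 * f) lam <->
  [\/ ((i : nat)%:Z - (j : nat)%:Z = 1 %[mod 4])%Z /\ 3 * s + 4 * t = -1,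
      ((i : nat)%:Z - (j : nat)%:Z = 2 %[mod 4])%Z /\ s = -3
    | ((i : nat)%:Z - (j : nat)%:Z = 3 %[mod 4])%Z /\ 3 * s - 4 * t = -1]).
  move=> lamE; have f_odd : odd f by move: f3; clear; lia.
  have pn : (p ^ n = 4 * f + 1)%N by rewrite -qE.
  have p1 := prime_1_mod4 p_prime p_odd pn f_odd.
  (* Odd [f] has forced [p = 1] modulo 4, which gives access to the sum of two squares. *)
  have [|qst _ s1 wst] := st_p1; first by move: p1; clear; lia.
  have [sE tE] : 2 * cnt f (val w) 0 + 1 = s /\ 2 * cnt f (val w) 1 = - t.
    apply: (@cnt_sum_two_squares _ _ _ cF w_prim f_odd p n) => //.
      by rewrite -qst q4f.
    by rewrite -wst q4f addnK mulKn.
  rewrite q4f sds_autocorr // sum_eta_autocorr //.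
  rewrite -(cnt_form_eq0 cF w_prim f_odd i_neq_j sE tE).
  split=> [/eqP|->]; last by rewrite mulr0.
  by rewrite mulf_eq0 -[_%:Z == 0]/(f == 0)%N gtn_eqF // => /eqP.
split=> [[lam [lamE sds]]|[f3 form]].
  have lam4 : 4 * lam = f%:Z - 3.
    apply: (intr_inj (R := rat)); rewrite rmorphM rmorphB /= lamE.
    by rewrite mulrC divfK.
  (* The congruence on [f] is exactly the integrality of [lam]. *)
  have f3 : (f = 3 %[mod 4])%N by move: lam4; clear; lia.
  by split=> //; apply/(fform f3 lam).
have [lam lam4] : exists lam, 4 * lam = f%:Z - 3.
  by exists ((f%:Z - 3) %/ 4)%Z; move: f3; clear; lia.
exists lam; split; last exact/fform.
have -> : f%:R - 3%:R = (f%:Z - 3)%:~R :> rat by rewrite rmorphB.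
by rewrite -lam4 rmorphM rmorph_nat mulrAC divff ?mul1r.
Qed.
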